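(* Let $R$ be a Noetherian one-dimensional local domain and let $M$ be a finitely generated $R$-module of non-zero rank. Then $$h(M)\ge \lambda\left(R/\operatorname{tr}_R(M)\right)\ge h(\operatorname{tr}_R(M)).$$ If in addition the completion $\widehat{R}$ is reduced, then $h(\operatorname{tr}_R(M))=\lambda(R/\operatorname{tr}_R(M))$.
   Context: $\lambda(\cdot)$ denotes length as an $R$-module. The trace ideal of an $R$-module $M$ is $\operatorname{tr}_R(M)=\sum_{\alpha\in \operatorname{Hom}_R(M,R)}\alpha(M)$. Invariant $h$: for a finitely generated $R$-module $M$ of non-zero rank over a one-dimensional Noetherian local domain $R$, $h(M):=\min\{\lambda(R/I)\mid I=\phi(M)\text{ for some }R\text{-homomorphism }\phi:M\to R\}$ (the zero map contributes $\infty$). For a non-zero ideal $J$ this is $h(J)=\min\{\lambda(R/I)\mid I\text{ an ideal of }R,\ I\cong J\}$. *)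

(* Defs.v *)
From HB Require Import structures.
From mathcomp Require Import all_boot all_order all_algebra generic_quotient.
From mathcomp Require Import boolp classical_sets functions.

Set Implicit Arguments.
Unset Strict Implicit.
Unset Printing Implicit Defensive.

Import Order.TTheory GRing.Theory.
Local Open Scope quotient_scope.
Local Open Scope ring_scope.

Variant enat := Fin of nat | Infty.

Definition enat_to_option (a : enat) := if a is Fin n then Some n else None.
Definition option_to_enat (a : option nat) := if a is Some n then Fin n else Infty.
Lemma enat_to_optionK : cancel enat_to_option option_to_enat.
Proof. by case. Qed.

HB.instance Definition _ := Choice.copy enat (can_type enat_to_optionK).

Definition enat_le (a b : enat) : bool :=
  match a, b with
  | _, Infty => true
  | Infty, Fin _ => false
  | Fin m, Fin n => (m <= n)%N
  end.

Lemma enat_le_refl : reflexive enat_le.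
Proof. by case=> //= n; exact: leqnn. Qed.
Lemma enat_le_anti : antisymmetric enat_le.
Proof. by case=> [m|] [n|] //= /anti_leq->. Qed.
Lemma enat_le_trans : transitive enat_le.
Proof. by case=> [m|] [n|] [p|] //=; exact: leq_trans. Qed.

Fact enat_display : Order.disp_t. Proof. exact: Order.Disp tt tt. Qed.

HB.instance Definition _ := Order.Le_isPOrder.Build enat_display enat
  enat_le_refl enat_le_anti enat_le_trans.

(* The supremum in [enat] of a set of naturals; [Fin 0] for the empty set. *)
Definition enat_sup (S : set nat) : enat :=
  match pselect (exists n, `[< S n >]), pselect (exists b, forall n, `[< S n >] -> (n <= b)%N) with
  | left exS, left bS => Fin (ex_maxn exS (projT2 (cid bS)))
  | left _, right _ => Infty
  | right _, _ => Fin 0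
  end.

(* The minimum of a set of extended naturals; [Infty] for the empty set. *)
Definition enat_min (S : set enat) : enat :=
  match pselect (exists n, `[< S (Fin n) >]) with
  | left exS => Fin (ex_minn exS)
  | right _ => Infty
  end.

Lemma enat_sup_ge (S : set nat) n : S n -> (Fin n <= enat_sup S)%O.
Proof.
rewrite /enat_sup => Sn; case: pselect => [exS|[]]; last first.
  by exists n; apply/asboolP.
case: pselect => // bS; case: ex_maxnP => i _; apply; exact/asboolP.
Qed.

Lemma enat_sup_le (S : set nat) a :
  (forall n, S n -> (Fin n <= a)%O) -> (enat_sup S <= a)%O.
Proof.
rewrite /enat_sup => Sa; case: pselect => [exS|_]; last by case: a Sa.
case: pselect => [bS|nb].
  by case: ex_maxnP => i /asboolP + _; exact: Sa.
case: a Sa => // b Sb; case: nb; exists b => n /asboolP; exact: Sb.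
Qed.

Lemma enat_min_le (S : set enat) a : S a -> (enat_min S <= a)%O.
Proof.
rewrite /enat_min; case: a => [n|] Sn; case: pselect => //.
  by move=> exS; case: ex_minnP => i _; apply; exact/asboolP.
by case; exists n; apply/asboolP.
Qed.

Lemma enat_min_mem (S : set enat) : (exists a, S a) -> S (enat_min S).
Proof.
rewrite /enat_min; case: pselect => [exS _|nS].
  by case: ex_minnP => i /asboolP.
by case=> -[n|//] Sn; case: nS; exists n; apply/asboolP.
Qed.

Section Modules.
Variables (R : pzRingType).
Implicit Types (V W : lmodType R).

Record submod V (N : submodClosed V) := Submod {
  submod_val : V;
  submod_valP : submod_val \in N
}.
HB.instance Definition _ V (N : submodClosed V) := [isSub for @submod_val V N].
HB.instance Definition _ V (N : submodClosed V) := [Choice of submod N by <:].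
HB.instance Definition _ V (N : submodClosed V) :=
  [SubChoice_isSubLmodule of submod N by <:].

(* [submodClosed] does not inherit from [zmodClosed], which [Quotient.quot] requires. *)
Definition zmod_of V (N : submodClosed V) : {pred V} := fun v => v \in N.
Fact zmod_of_closed V (N : submodClosed V) : zmod_closed (zmod_of N).
Proof. exact: GRing.submod_closedB (submodClosedP N). Qed.
HB.instance Definition _ V (N : submodClosed V) :=
  GRing.isZmodClosed.Build V (zmod_of N) (zmod_of_closed N).

Definition quotmod V (N : submodClosed V) : Type := Quotient.quot (zmod_of N).

Section QuotMod.
Variables (V : lmodType R) (N : submodClosed V).
Local Notation Q := (quotmod N).
HB.instance Definition _ : EqQuotient V (Quotient.equiv (zmod_of N)) Q :=
  EqQuotient.on (Quotient.quot (zmod_of N)).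
HB.instance Definition _ := GRing.Zmodule.on Q.
HB.instance Definition _ := ZmodQuotient.on Q.

Definition quotmod_scale (a : R) (x : Q) : Q := \pi_Q (a *: repr x).

Lemma quotmod_piE (v w : V) : (v - w \in N) -> \pi_Q v = \pi_Q w.
Proof.
move=> vw; apply/eqP.
by rewrite -[_ == _]/(v == w %[mod (Quotient.quot (zmod_of N))]) -Quotient.idealrBE.
Qed.

Lemma quotmod_repr (v : V) : repr (\pi_Q v) - v \in N.
Proof.
by rewrite -[_ \in N]/(_ \in zmod_of N) Quotient.idealrBE; apply/eqP; exact: reprK.
Qed.

Lemma quotmod_pi_scale a v : quotmod_scale a (\pi_Q v) = \pi_Q (a *: v).
Proof. by apply: quotmod_piE; rewrite -scalerBr rpredZ ?quotmod_repr. Qed.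

Lemma quotmod_scaleA a b v :
  quotmod_scale a (quotmod_scale b v) = quotmod_scale (a * b) v.
Proof. by elim/quotW: v => v; rewrite (quotmod_pi_scale b) 2!quotmod_pi_scale scalerA. Qed.
Lemma quotmod_scale1 : left_id 1 quotmod_scale.
Proof. by elim/quotW=> v; rewrite quotmod_pi_scale scale1r. Qed.
Lemma quotmod_scaleDr : right_distributive quotmod_scale +%R.
Proof.
move=> a; elim/quotW=> v; elim/quotW=> w.
by rewrite -raddfD 3!quotmod_pi_scale -raddfD scalerDr.
Qed.
Lemma quotmod_scaleDl v : {morph quotmod_scale^~ v : a b / a + b}.
Proof.
by elim/quotW: v => v a b; rewrite 3!quotmod_pi_scale -raddfD scalerDl.
Qed.

HB.instance Definition _ := GRing.Zmodule_isLmodule.Build R Q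
  quotmod_scaleA quotmod_scale1 quotmod_scaleDr quotmod_scaleDl.
End QuotMod.

Section Image.
Variables (V W : lmodType R) (f : {linear V -> W}).
Definition im_pred : {pred W} := fun w => `[< exists v, w = f v >].
Fact im_pred_closed : submod_closed im_pred.
Proof.
split=> [|a x y]; first by apply/asboolP; exists 0; rewrite linear0.
move=> /asboolP[v ->] /asboolP[w ->]; apply/asboolP.
by exists (a *: v + w); rewrite linearP.
Qed.
HB.instance Definition _ := GRing.isSubmodClosed.Build R W im_pred im_pred_closed.
Definition im : submodClosed W := im_pred.
End Image.

Definition finitely_generated V : Prop :=
  exists n (g : 'I_n -> V), forall v, exists a : 'I_n -> R, v = \sum_i a i *: g i.

Definition strict_chain (T : Type) n (N : 'I_n.+1 -> {pred T}) : Prop :=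
  forall i j : 'I_n.+1, (i < j)%N -> {subset N i <= N j} /\ exists2 x, x \in N j & x \notin N i.

Definition length V : enat := enat_sup [set n |
  exists N : 'I_n.+1 -> submodClosed V, strict_chain N].

Definition lin_indep V n (v : 'I_n -> V) : Prop :=
  forall a : 'I_n -> R, \sum_i a i *: v i = 0 -> forall i, a i = 0.

Definition rank V : enat := enat_sup [set n |
  exists v : 'I_n -> V, lin_indep v].

End Modules.

Notation ideal R := (submodClosed R^o).

Section Rings.
Variable R : comPzRingType.
Implicit Types I J P : ideal R.

Definition proper I : Prop := 1 \notin I.

Definition prime_ideal P : Prop :=
  proper P /\ forall x y : R, x * y \in P -> x \in P \/ y \in P.

Definition maximal_ideal I : Prop :=
  proper I /\ forall J, proper J -> {subset I <= J} -> J =i I.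

Definition local_ring I : Prop :=
  maximal_ideal I /\ forall J, maximal_ideal J -> J =i I.

Definition noetherian : Prop := forall I, finitely_generated (submod I).

Definition krull_dim : enat := enat_sup [set n |
  exists2 P : 'I_n.+1 -> ideal R, forall i, prime_ideal (P i) & strict_chain P].

Definition reduced : Prop := forall (x : R) n, x ^+ n = 0 -> x = 0.

Section IdealPower.
Variables (I : ideal R) (k : nat).
Definition idealX_pred : {pred R^o} := fun r => `[< exists n (x : 'I_n -> 'I_k -> R),
  (forall i j, x i j \in I) /\ exists a : 'I_n -> R, r = \sum_i a i * \prod_j x i j >].
Fact idealX_closed : submod_closed idealX_pred.
Proof.
split=> [|a r s].
  by apply/asboolP; exists 0, (fun _ _ => 0); split=> [[]//|]; exists (fun=> 0); rewrite big_ord0.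
move=> /asboolP[n [x [xI [b ->]]]] /asboolP[m [y [yI [c ->]]]]; apply/asboolP.
exists (n + m)%N, (fun i : 'I_(n + m) => match fintype.split i with inl i => x i | inr i => y i end); split.
  by move=> i j; case: fintype.split.
exists (fun i : 'I_(n + m) => match fintype.split i with inl i => a * b i | inr i => c i end).
rewrite big_split_ord /=; congr +%R.
  rewrite scaler_sumr; apply: eq_bigr => i _.
  by rewrite (unsplitK (inl i)) -mulrA.
by apply: eq_bigr => i _; rewrite (unsplitK (inr i)).
Qed.
HB.instance Definition _ := GRing.isSubmodClosed.Build R R^o idealX_pred idealX_closed.
Definition idealX : ideal R := idealX_pred.
End IdealPower.

Definition quotring I : Type := Quotient.quot (zmod_of I).

Section QuotRing.
Variable I : ideal R.
Local Notation Q := (quotring I).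
HB.instance Definition _ : EqQuotient R^o (Quotient.equiv (zmod_of I)) Q :=
  EqQuotient.on (Quotient.quot (zmod_of I)).
HB.instance Definition _ := GRing.Zmodule.on Q.
HB.instance Definition _ := ZmodQuotient.on Q.

Let pi (r : R) : Q := \pi_Q (r : R^o).
Let rep (x : Q) : R := repr x.
Definition quotring_one : Q := pi 1.
Definition quotring_mul (x y : Q) : Q := pi (rep x * rep y).

Let repK x : pi (rep x) = x. Proof. exact: reprK. Qed.
Let piD : {morph pi : x y / x + y}. Proof. by move=> x y; exact: raddfD. Qed.
Let piE (v w : R) : (v - w \in I) -> pi v = pi w.
Proof. exact: quotmod_piE. Qed.
Let repr_pi (v : R) : rep (pi v) - v \in I.
Proof. exact: quotmod_repr. Qed.

Let idealM (r x : R) : x \in I -> r * x \in I.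
Proof. exact: (@rpredZ _ _ I). Qed.

Lemma quotring_pi_mul x y : quotring_mul (pi x) (pi y) = pi (x * y).
Proof.
apply: piE; set a := rep _; set b := rep _.
have -> : a * b - x * y = a * (b - y) + y * (a - x).
  by rewrite !mulrBr addrA [y * a]mulrC subrK mulrC [x * y]mulrC [b * a]mulrC.
by apply: (@rpredD _ I); apply: idealM; exact: repr_pi.
Qed.

Let piP (P : Q -> Prop) : (forall r, P (pi r)) -> forall x, P x.
Proof. by move=> Ppi x; rewrite -[x]repK. Qed.

Lemma quotring_mulA : associative quotring_mul.
Proof.
elim/piP=> x; elim/piP=> y; elim/piP=> z.
by rewrite (quotring_pi_mul y z) (quotring_pi_mul x y) 2!quotring_pi_mul mulrA.
Qed.
Lemma quotring_mulC : commutative quotring_mul.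
Proof. by elim/piP=> x; elim/piP=> y; rewrite 2!quotring_pi_mul mulrC. Qed.
Lemma quotring_mul1 : left_id quotring_one quotring_mul.
Proof. by elim/piP=> x; rewrite quotring_pi_mul mul1r. Qed.
Lemma quotring_mulD : left_distributive quotring_mul +%R.
Proof.
elim/piP=> x; elim/piP=> y; elim/piP=> z.
by rewrite -piD 3!quotring_pi_mul -piD mulrDl.
Qed.

HB.instance Definition _ := GRing.Zmodule_isComPzRing.Build Q
  quotring_mulA quotring_mulC quotring_mul1 quotring_mulD.
End QuotRing.

End Rings.

(* The [I]-adic completion, as [I]-adic Cauchy sequences modulo null sequences. *)
Section Completion.
Variables (R : comPzRingType) (I : ideal R).

Definition cauchy_pred : {pred nat -> R} := fun x => `[< forall k, exists N, forall m n,
  (N <= m)%N -> (N <= n)%N -> x m - x n \in idealX I k >].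

Let idealM k (r x : R) : x \in idealX I k -> r * x \in idealX I k.
Proof. exact: (@rpredZ _ _ (idealX I k)). Qed.
Let idealD k (x y : R) : x \in idealX I k -> y \in idealX I k -> x + y \in idealX I k.
Proof. exact: (@rpredD _ (idealX I k)). Qed.

Fact cauchy_closed : subring_closed cauchy_pred.
Proof.
split.
- apply/asboolP => k; exists 0%N => m n _ _.
  by rewrite subrr; exact: (@rpred0 _ (idealX I k)).
- move=> x y /asboolP cx /asboolP cy; apply/asboolP => k.
  have [N1 h1] := cx k; have [N2 h2] := cy k.
  exists (maxn N1 N2) => m n; rewrite !geq_max => /andP[m1 m2] /andP[n1 n2].
  rewrite -[(x - y) m]/(x m - y m) -[(x - y) n]/(x n - y n).
  have -> : x m - y m - (x n - y n) = (x m - x n) + (y n - y m).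
    by rewrite opprB [y n - x n]addrC addrACA [- y m + _]addrC.
  by apply: idealD; [exact: h1 | exact: h2].
- move=> x y /asboolP cx /asboolP cy; apply/asboolP => k.
  have [N1 h1] := cx k; have [N2 h2] := cy k.
  exists (maxn N1 N2) => m n; rewrite !geq_max => /andP[m1 m2] /andP[n1 n2].
  rewrite -[(x * y) m]/(x m * y m) -[(x * y) n]/(x n * y n).
  have -> : x m * y m - x n * y n = x m * (y m - y n) + y n * (x m - x n).
    by rewrite !mulrBr addrA [y n * x m]mulrC subrK [y n * _]mulrC.
  by apply: idealD; apply: idealM; [exact: h2 | exact: h1].
Qed.
HB.instance Definition _ :=
  GRing.isSubringClosed.Build (nat -> R) cauchy_pred cauchy_closed.

Record cauchy_seq := CauchySeq {
  cauchy_val : nat -> R;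
  cauchy_valP : cauchy_val \in cauchy_pred
}.
HB.instance Definition _ := [isSub for cauchy_val].
HB.instance Definition _ := [Choice of cauchy_seq by <:].
HB.instance Definition _ := GRing.SubChoice_isSubComPzRing.Build
  (nat -> R) cauchy_pred cauchy_seq cauchy_closed.

Definition null_pred : {pred cauchy_seq^o} := fun x => `[< forall k, exists N, forall n,
  (N <= n)%N -> val (x : cauchy_seq) n \in idealX I k >].
Fact null_closed : submod_closed null_pred.
Proof.
split.
- by apply/asboolP => k; exists 0%N => n _; exact: (@rpred0 _ (idealX I k)).
- move=> a x y /asboolP cx /asboolP cy; apply/asboolP => k.
  have [N1 h1] := cx k; have [N2 h2] := cy k.
  exists (maxn N1 N2) => n; rewrite !geq_max => /andP[n1 n2].
  rewrite -[val _ n]/(val (a : cauchy_seq) n * val (x : cauchy_seq) n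
    + val (y : cauchy_seq) n).
  by apply: idealD; [apply: idealM; exact: h1 | exact: h2].
Qed.
HB.instance Definition _ :=
  GRing.isSubmodClosed.Build cauchy_seq cauchy_seq^o null_pred null_closed.
Definition null_seq : ideal cauchy_seq := null_pred.

Definition completion : comPzRingType := quotring null_seq.

End Completion.

Section Trace.
Variables (R : comPzRingType) (M : lmodType R).

Definition trace_pred : {pred R^o} := fun r => `[< exists n
  (alpha : 'I_n -> {linear M -> R^o}) (x : 'I_n -> M), r = \sum_i alpha i (x i) >].
Fact trace_closed : submod_closed trace_pred.
Proof.
split=> [|a r s].
  by apply/asboolP; exists 0%N, (fun=> \0), (fun=> 0); rewrite big_ord0.
move=> /asboolP[n [f [x ->]]] /asboolP[m [g [y ->]]]; apply/asboolP.
exists (n + m)%N, (fun i : 'I_(n + m) => match fintype.split i with inl i => f i | inr i => g i end).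
exists (fun i : 'I_(n + m) => match fintype.split i with inl i => a *: x i | inr i => y i end).
rewrite big_split_ord /=; congr +%R.
  rewrite scaler_sumr; apply: eq_bigr => i _.
  by rewrite (unsplitK (inl i)) linearZ.
by apply: eq_bigr => i _; rewrite (unsplitK (inr i)).
Qed.
HB.instance Definition _ := GRing.isSubmodClosed.Build R R^o trace_pred trace_closed.
Definition trace_ideal : ideal R := trace_pred.

(* The zero map contributes [length (R / 0)], which is [Infty] as soon as [R] is not
   artinian, in particular for a domain of dimension one. *)
Definition h : enat := enat_min [set l |
  exists phi : {linear M -> R^o}, l = length (quotmod (im phi))].

End Trace.

(* Main.v *)
Require Import Defs.
From mathcomp Require Import all_boot all_order all_algebra.
From HB Require Import structures.
From mathcomp Require Import generic_quotient boolp classical_sets.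

(** The trace ideal [T] of [M] contains the image of every linear form on [M],
    and [R / T] is a quotient of [R / I] whenever the ideal [I] is contained in
    [T], so that the length of [R / I] is at least that of [R / T]
    ([length_quotmod_sub]).  Minimizing over the images [I] of forms on [M] gives
    the first inequality ([length_quotmod_le_h]), and the inclusion of [T] in [R],
    a form on [T] with image [T], gives the second
    ([h_submod_le_length_quotmod]).

    The equality rests on the idempotence of the trace: a form on [T] composed
    with a form on [M] is again a form on [M], so every form on [T] takes its
    values in [T], that is, the trace ideal of [T] is contained in [T]
    ([trace_trace_sub]).  The first inequality, applied to [T] in place of [M],
    then bounds [h T] from below by the length of [R / T]. *)

Set Implicit Arguments.
Unset Strict Implicit.
Unset Printing Implicit Defensive.

Import Order.TTheory GRing.Theory.
Local Open Scope quotient_scope.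
Local Open Scope ring_scope.

Section Preimage.
Variables (R : pzRingType) (V W : lmodType R) (f : {linear V -> W}).
Variable N : submodClosed W.

Definition preim_pred : {pred V} := fun v => f v \in N.

Lemma in_preim v : (v \in preim_pred) = (f v \in N). Proof. by []. Qed.

Fact preim_pred_closed : submod_closed preim_pred.
Proof.
split=> [|a x y]; rewrite !in_preim ?linear0 ?rpred0 // => fx fy.
by rewrite linearP rpredD ?rpredZ.
Qed.

HB.instance Definition _ :=
  GRing.isSubmodClosed.Build R V preim_pred preim_pred_closed.

Definition preim : submodClosed V := preim_pred.

End Preimage.

(** Taking preimages along a surjection keeps the inclusions of a chain of
    submodules strict. *)
Lemma length_surj (R : pzRingType) (V W : lmodType R) (f : {linear V -> W}) :
  (forall w, exists v, f v = w) -> (length W <= length V)%O.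
Proof.
move=> f_surj; apply: enat_sup_le => n [N chainN]; apply: enat_sup_ge.
exists (fun i => preim f (N i)) => i j /chainN[sNij [y yNj yNi]].
split=> [x|]; first exact: sNij.
by have [x fx] := f_surj y; exists x; rewrite unfold_in /= /preim_pred fx.
Qed.

Section QuotientMap.
Variables (R : pzRingType) (V : lmodType R) (N N' : submodClosed V).
Hypothesis sNN' : {subset N <= N'}.

Definition quot_map (x : quotmod N) : quotmod N' := \pi_(quotmod N') (repr x).

Lemma quot_map_pi v : quot_map (\pi_(quotmod N) v) = \pi_(quotmod N') v.
Proof. by apply: quotmod_piE; apply: sNN'; exact: quotmod_repr. Qed.

Fact quot_map_linear : linear quot_map.
Proof.
move=> a; elim/quotW=> v; elim/quotW=> w.
have scaleE (P : submodClosed V) u : a *: \pi_(quotmod P) u = \pi_(quotmod P) (a *: u).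
  exact: quotmod_pi_scale.
by rewrite scaleE -raddfD !quot_map_pi scaleE -raddfD.
Qed.

HB.instance Definition _ :=
  GRing.isLinear.Build R (quotmod N) (quotmod N') _ quot_map quot_map_linear.

Lemma length_quotmod_sub : (length (quotmod N') <= length (quotmod N))%O.
Proof.
apply: (@length_surj _ _ _ quot_map); elim/quotW=> v.
by exists (\pi v); exact: quot_map_pi.
Qed.

End QuotientMap.

Section Trace.
Variables (R : comPzRingType) (M : lmodType R).

Lemma linear_form_in_trace (phi : {linear M -> R^o}) x : phi x \in trace_ideal M.
Proof.
by apply/asboolP; exists 1, (fun=> phi), (fun=> x); rewrite big_ord1.
Qed.

(** Allowing [T] to be larger than the trace makes the bound usable for the trace
    of [M] itself and, with [submod T] as the module, for the ideal [T] of which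
    the trace of [submod T] is only known to be a part. *)
Lemma length_quotmod_le_h (T : ideal R) :
  {subset trace_ideal M <= T} -> (length (quotmod T) <= h M)%O.
Proof.
move=> sMT.
have [phi ->] : [set l | exists phi : {linear M -> R^o},
    l = length (quotmod (im phi))]%classic (h M).
  by apply: enat_min_mem; exists (length (quotmod (im (\0 : {linear M -> R^o})))), \0.
apply: length_quotmod_sub => y /asboolP[x ->].
by apply: sMT; exact: linear_form_in_trace.
Qed.

End Trace.

Section SubmoduleInclusion.
Variables (R : comPzRingType) (I : ideal R).

Lemma h_submod_le_length_quotmod : (h (submod I) <= length (quotmod I))%O.
Proof.
pose incl : {linear submod I -> R^o} := val.
apply: (@le_trans _ _ (length (quotmod (im incl)))).
  by apply: enat_min_le; exists incl.
apply: length_quotmod_sub => x xI; apply/asboolP.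
by exists (Submod xI).
Qed.

End SubmoduleInclusion.

Section TraceOfTrace.
Variables (R : comPzRingType) (M : lmodType R).
Local Notation T := (trace_ideal M).

Section Corestriction.
Variable alpha : {linear M -> R^o}.

Definition trace_corestr (x : M) : submod T :=
  Submod (linear_form_in_trace alpha x).

Fact trace_corestr_linear : linear trace_corestr.
Proof. by move=> a x y; apply: val_inj; rewrite /= linearP. Qed.

HB.instance Definition _ :=
  GRing.isLinear.Build R M (submod T) _ trace_corestr trace_corestr_linear.

End Corestriction.

(** An element of the trace is a sum of values of forms [alpha i] on [M], so a
    form [phi] on the trace sends it to a sum of values of the forms obtained by
    composing [phi] with the [alpha i]. *)
Lemma linear_form_trace_stable (phi : {linear submod T -> R^o}) t : phi t \in T.
Proof.
have /asboolP[n [alpha [x tE]]] := submod_valP t.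
have -> : t = \sum_i trace_corestr (alpha i) (x i).
  by apply: val_inj; rewrite raddf_sum.
rewrite raddf_sum rpred_sum // => i _.
exact: (linear_form_in_trace (phi \o trace_corestr (alpha i))).
Qed.

Lemma trace_trace_sub : {subset trace_ideal (submod T) <= T}.
Proof.
move=> r /asboolP[n [phi [t ->]]]; rewrite rpred_sum // => i _.
exact: linear_form_trace_stable.
Qed.

End TraceOfTrace.

Theorem proposition3p4 (R : idomainType) (m : ideal R) (M : lmodType R) :
  noetherian R -> local_ring m -> krull_dim R = Fin 1 ->
  finitely_generated M -> rank M <> Fin 0 ->
  ((h M >= length (quotmod (trace_ideal M)))%O /\
   (length (quotmod (trace_ideal M)) >= h (submod (trace_ideal M)))%O) /\
  (reduced (completion m) ->
   h (submod (trace_ideal M)) = length (quotmod (trace_ideal M))).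
Proof.
move=> _ _ _ _ _.
have hT_le := h_submod_le_length_quotmod (trace_ideal M).
split=> [|_]; first by split=> //; exact: length_quotmod_le_h.
apply/le_anti/andP; split=> //.
by apply: length_quotmod_le_h; exact: trace_trace_sub.
Qed.
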